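(* Let $\mathbf u=(u^1,\dots,u^n)^{\intercal}$ be a vector of dependent variables. The operator $$\mathfrak H=D_x+\sum_{i=1}^{n-1}\sum_{j=i+1}^nJ_{ij}\mathbf u\,D_x^{-1}(J_{ij}\mathbf u)^{\intercal},$$ where the $J_{ij}$, given by $(J_{ij})_{kl}=\delta_{ik}\delta_{jl}-\delta_{il}\delta_{jk}$, are the generators of $\mathfrak o_n$, is a cosymplectic (or Hamiltonian) operator.
   Context: $D_x$ is the total $x$-derivative and $D_x^{-1}$ its formal inverse, formally skew-adjoint, with integration constants zero; $\int\cdot\,dx$ is taken modulo total $x$-derivatives; $\langle\cdot,\cdot\rangle$ is the standard inner product on $\mathbb R^n$. $\mathfrak o_n$ is the Lie algebra of antisymmetric $n\times n$ matrices. The operator acts on $n$-vectors by $\mathfrak H\xi=D_x\xi+\sum_{i<j}J_{ij}\mathbf u\,D_x^{-1}(\langle J_{ij}\mathbf u,\xi\rangle)$. With the Fréchet derivative $\mathfrak H'[P]=\frac{d}{d\epsilon}\big|_{\epsilon=0}\mathfrak H(\mathbf u+\epsilon P)$, cosymplectic (Hamiltonian) means that $\mathfrak H$ is formally skew-adjoint and its Schouten bracket $[\mathfrak H,\mathfrak H]$ vanishes, i.e. $\int\big(\langle\xi_1,\mathfrak H'[\mathfrak H\xi_2]\xi_3\rangle+\text{cyclic permutations of }(1,2,3)\big)dx=0$ for all $\xi_1,\xi_2,\xi_3$; equivalently, the bracket defined by $\mathfrak H$ satisfies the Jacobi identity. *)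

(* Defs.v *)
From HB Require Import structures.
From mathcomp Require Import all_boot all_order all_algebra ring.
From mathcomp.multinomials Require Import mpoly.

Set Implicit Arguments.
Unset Strict Implicit.
Unset Printing Implicit Defensive.

Import GRing.Theory Num.Theory.
Local Open Scope ring_scope.

(* Formal calculus with [D_x], [D_x^-1] and k test functions.

   D_x^-1 cannot be a total inverse of D_x: every density f = D_x (D_x^-1 f)
   would then be a total derivative and [\int f dx] would vanish identically.
   What is meant formally is that [D_x^-1] acts on expressions containing some
   of the test functions, while a density contains all of them and is read
   modulo D_x of densities of the same kind.  So [deg S f] says that f is
   linear in each test function with index in S and free of the others:
   [deg set0] are the differential functions of the dependent variables,
   [D_x] is inverted on every [deg S] with S nonempty and proper, and the
   functionals are [deg setT] modulo [D_x (deg setT)].  The two-sided inverse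
   expresses that integration constants are zero; the skew-adjointness
   [\int f (D_x^-1 g) = - \int (D_x^-1 f) g] for complementary degrees follows,
   D_x^-1 f * D_x^-1 g being of full degree.  Outside these degrees the values
   of [Dinv] are irrelevant. *)
Record calculus (R : realFieldType) (k : nat) := Calculus {
  dens :> comAlgType R;
  Dx : {linear dens -> dens};
  Dinv : {linear dens -> dens};
  deg : {set 'I_k} -> dens -> Prop;
  DxM : forall f g : dens, Dx (f * g) = Dx f * g + f * Dx g;
  deg0 : forall S, deg S 0;
  deg1 : deg set0 1;
  deg_lin : forall S (c : R) (f g : dens),
    deg S f -> deg S g -> deg S (c *: f + g);
  degM : forall (S S' : {set 'I_k}) (f g : dens), [disjoint S & S'] ->
    deg S f -> deg S' g -> deg (S :|: S') (f * g);
  deg_Dx : forall S (f : dens), deg S f -> deg S (Dx f);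
  deg_Dinv : forall S (f : dens), S != set0 -> S != setT ->
    deg S f -> deg S (Dinv f);
  DxK : forall S (f : dens), S != set0 -> S != setT ->
    deg S f -> Dinv (Dx f) = f;
  DinvK : forall S (f : dens), S != set0 -> S != setT ->
    deg S f -> Dx (Dinv f) = f
}.

Definition vdeg (R : realFieldType) (k n : nat) (C : calculus R k)
    (S : {set 'I_k}) (v : 'cV[C]_n) : Prop :=
  forall i, deg S (v i 0).

(* [int_eq f g] is [\int f dx = \int g dx]. *)
Definition int_eq (R : realFieldType) (k : nat) (C : calculus R k)
    (f g : C) : Prop :=
  exists2 h : C, deg setT h & f - g = Dx C h.

Definition dot (T : comNzRingType) (n : nat) (v w : 'cV[T]_n) : T :=
  \sum_(i < n) v i 0 * w i 0.

(* An operator [O T D I u xi] is given uniformly in the ring T, in the maps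
   D and I standing for [D_x] and [D_x^-1], and in the dependent variables u,
   so that u can be replaced by [u + eps P]. *)
Definition operator (n : nat) : Type :=
  forall T : comNzRingType, (T -> T) -> (T -> T) ->
    'cV[T]_n -> 'cV[T]_n -> 'cV[T]_n.

Definition act (R : realFieldType) (k n : nat) (O : operator n)
    (C : calculus R k) (u xi : 'cV[C]_n) : 'cV[C]_n :=
  O C (Dx C) (Dinv C) u xi.

(* [O'[P] xi]: the derivative at 'X = 0 of [O (u + 'X P) xi], computed over
   {poly C} with D_x and D_x^-1 extended coefficientwise. *)
Definition frechet (R : realFieldType) (k n : nat) (O : operator n)
    (C : calculus R k) (u P xi : 'cV[C]_n) : 'cV[C]_n :=
  map_mx (fun q : {poly C} => (q^`()).[0])
    (O {poly C} (map_poly (Dx C)) (map_poly (Dinv C))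
       (map_mx polyC u + 'X *: map_mx polyC P) (map_mx polyC xi)).

Definition skew_adjoint (R : realFieldType) (n : nat) (O : operator n) : Prop :=
  forall (C : calculus R 2) (u xi1 xi2 : 'cV[C]_n),
    vdeg set0 u -> vdeg [set 0] xi1 -> vdeg [set 1] xi2 ->
    int_eq (dot xi1 (act O u xi2)) (- dot (act O u xi1) xi2).

Definition schouten_density (R : realFieldType) (k n : nat) (O : operator n)
    (C : calculus R k) (u xi1 xi2 xi3 : 'cV[C]_n) : C :=
  dot xi1 (frechet O u (act O u xi2) xi3).

Definition schouten_vanishes (R : realFieldType) (n : nat) (O : operator n)
  : Prop :=
  forall (C : calculus R 3) (u xi1 xi2 xi3 : 'cV[C]_n),
    vdeg set0 u ->
    vdeg [set 0] xi1 -> vdeg [set 1] xi2 -> vdeg [set 2%:R] xi3 ->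
    int_eq (schouten_density O u xi1 xi2 xi3 +
            schouten_density O u xi2 xi3 xi1 +
            schouten_density O u xi3 xi1 xi2) 0.

Definition cosymplectic (R : realFieldType) (n : nat) (O : operator n) : Prop :=
  skew_adjoint R O /\ schouten_vanishes R O.

Definition Jmx (T : comNzRingType) (n : nat) (i j : 'I_n) : 'M[T]_n :=
  \matrix_(k, l) ((i == k)%:R * (j == l)%:R - (i == l)%:R * (j == k)%:R).

Definition Hop (n : nat) : operator n := fun T D I u xi =>
  map_mx D xi +
  \sum_(i < n) \sum_(j < n | (i < j)%N)
    I (dot (Jmx T i j *m u) xi) *: (Jmx T i j *m u).

(* There are calculi with densities of nonzero integral, for any positive
   number k.+1 of test functions: take polynomials in y = e^x and z = e^-x as
   densities, D_x = y d/dy - z d/dz, and let [deg S] consist of the sums of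
   exponentials e^(m x) with m congruent to #|S| modulo k.+1.  On a nonempty
   proper S no exponent m vanishes, so D_x is invertible; in full degree
   e^(0 x) = 1 occurs and is not a total derivative. *)
Definition mwt (R : realFieldType) (m : 'X_{1..2}) : R :=
  (m 0%R)%:R - (m 1%R)%:R.

Definition expD (R : realFieldType) (p : {mpoly R[2]}) : {mpoly R[2]} :=
  'X_0 * p^`M(0) - 'X_1 * p^`M(1).

Definition expI (R : realFieldType) (p : {mpoly R[2]}) : {mpoly R[2]} :=
  \sum_(m <- msupp p) (p@_m / mwt R m) *: 'X_[m].

Definition expdeg (R : realFieldType) (k : nat) (S : {set 'I_k.+1})
    (p : {mpoly R[2]}) : Prop :=
  forall m, p@_m != 0 -> m 0%R = (m 1%R + #|S|)%N %[mod k.+1].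

Lemma coefXd (R : realFieldType) (i : 'I_2) (p : {mpoly R[2]}) m :
  ('X_i * p^`M(i))@_m = p@_m *+ m i.
Proof.
rewrite [p in LHS]mpolyE [p in RHS]mpolyE !linear_sum mulr_sumr /= !linear_sum /=.
rewrite -sumrMnl; apply: eq_bigr => s _.
rewrite mderivZ -scalerAr !mcoeffZ mderivX -scalerAr mcoeffZ -mpolyXD.
rewrite !mcoeffX -mulrnAr; congr (_ * _).
case si: (s i) => [|q].
  by rewrite mul0r; case: eqP => [<-|]; rewrite ?si ?mulr0n ?mul0rn.
have -> : (U_(i) + (s - U_(i)))%MM = s.
  by rewrite addmC submK //; apply/mnm_lepP => j; rewrite mnm1E; case: eqP => // <-; rewrite si.
by rewrite -si; case: eqP => [->|_]; rewrite ?mulr1 ?mulr0 ?mul0rn.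
Qed.

Lemma coef_expD (R : realFieldType) (p : {mpoly R[2]}) m :
  (expD p)@_m = mwt R m * p@_m.
Proof. by rewrite mcoeffB !coefXd mulrBl !mulr_natl. Qed.

Lemma coef_expI (R : realFieldType) (p : {mpoly R[2]}) m :
  (expI p)@_m = p@_m / mwt R m.
Proof.
rewrite linear_sum /=; case: (boolP (m \in msupp p)) => [mp|mp].
  rewrite (bigD1_seq m) ?msupp_uniq //= mcoeffZ mcoeffX eqxx mulr1 big1 ?addr0 //.
  by move=> s sm; rewrite mcoeffZ mcoeffX (negPf sm) mulr0.
rewrite (memN_msupp_eq0 mp) mul0r big_seq big1 // => s sp.
rewrite mcoeffZ mcoeffX; case: eqP => [sm|_]; last by rewrite mulr0.
by rewrite -sm sp in mp.
Qed.

Lemma expD_linear (R : realFieldType) : linear (@expD R).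
Proof.
by move=> c f g; apply/mpolyP => m; rewrite !(mcoeffD, mcoeffZ, coef_expD); ring.
Qed.

Lemma expI_linear (R : realFieldType) : linear (@expI R).
Proof.
by move=> c f g; apply/mpolyP => m; rewrite !(mcoeffD, mcoeffZ, coef_expI); ring.
Qed.

HB.instance Definition _ (R : realFieldType) :=
  GRing.isLinear.Build R {mpoly R[2]} {mpoly R[2]} _ (@expD R) (@expD_linear R).
HB.instance Definition _ (R : realFieldType) :=
  GRing.isLinear.Build R {mpoly R[2]} {mpoly R[2]} _ (@expI R) (@expI_linear R).

Lemma expdeg_wt (R : realFieldType) (k : nat) (S : {set 'I_k.+1})
    (f : {mpoly R[2]}) m :
  S != set0 -> S != setT -> expdeg S f -> f@_m != 0 -> mwt R m != 0.
Proof.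
move=> S0 ST df /df; apply: contraPneq => /eqP; rewrite subr_eq0 eqr_nat => /eqP ->.
apply/eqP; rewrite -[X in X == _ %[mod _]]addn0 eqn_modDl mod0n modn_small.
  by rewrite eq_sym cards_eq0.
by have := proper_card (_ : S \proper setT); rewrite cardsT card_ord; apply; rewrite properT.
Qed.

Lemma int_nontrivial (R : realFieldType) (k : nat) :
  exists (C : calculus R k.+1) (f : C), deg setT f /\ ~ int_eq f 0.
Proof.
unshelve eexists (@Calculus R k.+1 {mpoly R[2]} (@expD R) (@expI R)
  (@expdeg R k) _ _ _ _ _ _ _ _ _).
- by move=> f g /=; rewrite /expD !mderivM; ring.
- by move=> S m; rewrite mcoeff0 eqxx.
- move=> m; rewrite mcoeff1 cards0 addn0.
  by case: (m =P 0%MM) => [->|]; rewrite ?mnm0E ?eqxx.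
- move=> S c f g df dg m; rewrite mcoeffD mcoeffZ => fg.
  case: (eqVneq f@_m 0) => [f0|/df//].
  by apply: dg; rewrite f0 mulr0 add0r in fg.
- move=> S S' f g SS' df dg m; rewrite -mcoeff_msupp => /msuppM_le.
  case/allpairsP => [[a b] /= [af bg ->]].
  rewrite mcoeff_msupp in af; rewrite mcoeff_msupp in bg.
  rewrite cardsU disjoint_setI0 // cards0 subn0 !mnmDE.
  by rewrite addnACA -modnDm (df _ af) (dg _ bg) modnDm.
- by move=> S f df m /=; rewrite coef_expD mulf_eq0 negb_or => /andP[_ /df].
- by move=> S f _ _ df m /=; rewrite coef_expI mulf_eq0 negb_or => /andP[/df].
- move=> S f S0 ST df; apply/mpolyP => m /=; rewrite coef_expI coef_expD.
  case: (eqVneq f@_m 0) => [->|fm]; first by rewrite mulr0 mul0r.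
  by rewrite mulrC mulKf // (expdeg_wt S0 ST df).
- move=> S f S0 ST df; apply/mpolyP => m /=; rewrite coef_expD coef_expI.
  case: (eqVneq f@_m 0) => [->|fm]; first by rewrite mul0r mulr0.
  by rewrite mulrC divfK // (expdeg_wt S0 ST df).
exists 1; split=> /=.
  move=> m; rewrite mcoeff1 cardsT card_ord modnDr.
  by case: (m =P 0%MM) => [->|]; rewrite ?mnm0E ?eqxx.
case=> h _ /(congr1 (mcoeff 0%MM)); rewrite /= subr0 mcoeff1 eqxx coef_expD.
by rewrite /mwt !mnm0E subrr mul0r; move/eqP; rewrite oner_eq0.
Qed.

(* Main.v *)
Require Import Defs.
From mathcomp Require Import all_boot all_order all_algebra.
From mathcomp Require Import ring.

Set Implicit Arguments.
Unset Strict Implicit.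
Unset Printing Implicit Defensive.

Import GRing.Theory Num.Theory.
Local Open Scope ring_scope.

(** Write [wedge v w] for the alternating matrix [v w^T - w v^T].  The pair sum
    over the generators of o_n collapses ([Hop_wedge]) to
      H xi = D xi + W u,   W = D^-1 (wedge xi u),
    where W, called [potential xi], is alternating and linear in xi, and
    D W = wedge xi u.  Everything below is integration by parts with this
    identity.

    Skew-adjointness: the nonlocal part of [dot xi1 (H xi2)] is the pairing of
    W2 with D W1, which is skew modulo total derivatives, as is
    [dot xi1 (D xi2)].

    Jacobi identity: put P = H xi2 = D xi2 + W2 u.  The derivative of H in the
    direction P, applied to xi3, is W3 P + D^-1 (wedge xi3 P) u
    ([frechet_Hop]).  Against xi1, the second term is the pairing of
    D^-1 (wedge xi3 P) with D W1; moving D over removes the outer D^-1, and the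
    first density becomes ([schouten_density_Hop])
      dot xi1 (W3 P) - dot xi3 (W1 P).
    Only the W's are nonlocal now, and the cyclic sum is exactly the D of
      dot xi1 (W3 xi2) + dot xi2 (W1 xi3) + dot xi3 (W2 xi1) + tr (W1 W2 W3).
    The derivatives falling on the xi's in the first three terms give the part
    of the sum coming from D xi2 in P, and those falling on the W's there
    produce products of four vectors that cancel in the cyclic sum
    ([Dx_dot_potential]); the derivative of the trace gives the part coming
    from W2 u ([Dx_tr_potential]). *)

(** * Alternating matrices and the operator in matrix form *)

Section DotWedge.
Variables (T : comNzRingType) (n : nat).
Implicit Types (a b v w u : 'cV[T]_n) (A B : 'M[T]_n).

Definition wedge v w : 'M[T]_n := v *m w^T - w *m v^T.

(** The diagonal is listed separately because T may have characteristic two. *)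
Definition alternating A : Prop :=
  (forall i, A i i = 0) /\ (forall i j, A i j = - A j i).

(** On alternating matrices this is [- tr (A B) / 2]; summing over [i < j] avoids
    dividing by two. *)
Definition pair A B : T := \sum_(i < n) \sum_(j < n | (i < j)%N) A i j * B i j.

Lemma wedgeE v w i j : wedge v w i j = v i 0 * w j 0 - w i 0 * v j 0.
Proof. by rewrite !mxE !big_ord1 !mxE. Qed.

Lemma alternating_wedge v w : alternating (wedge v w).
Proof. by split=> [i|i j]; rewrite !wedgeE; ring. Qed.

Lemma alternating_map (f : {additive T -> T}) A :
  alternating A -> alternating (map_mx f A).
Proof.
move=> [A0 AN]; split=> [i|i j]; rewrite !mxE; first by rewrite A0 raddf0.
by rewrite AN raddfN.
Qed.

Lemma pairC A B : pair A B = pair B A.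
Proof. by apply: eq_bigr => i _; apply: eq_bigr => j _; rewrite mulrC. Qed.

Lemma dotE v w : dot v w = (v^T *m w) 0 0.
Proof. by rewrite mxE; apply: eq_bigr => i _; rewrite mxE. Qed.

Lemma dotC v w : dot v w = dot w v.
Proof. by apply: eq_bigr => i _; rewrite mulrC. Qed.

Lemma dotDr a v w : dot a (v + w) = dot a v + dot a w.
Proof. by rewrite !dotE mulmxDr mxE. Qed.

Lemma dot_delta k v : dot (delta_mx k 0) v = v k 0.
Proof. by rewrite dotE trmx_delta -rowE mxE. Qed.

Lemma dot_mulmx_alternating A v w :
  alternating A -> dot v (A *m w) = - dot w (A *m v).
Proof.
move=> [_ AN]; rewrite /dot -sumrN.
under eq_bigr => i _ do rewrite mxE mulr_sumr.
rewrite exchange_big; apply: eq_bigr => j _ /=.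
rewrite mxE mulr_sumr -sumrN; apply: eq_bigr => i _.
by rewrite (AN j i); ring.
Qed.

(** This turns [dot xi (A u)] into a pairing of A with [wedge xi u], that is,
    with the derivative of the potential of xi, so that it can be integrated by
    parts; read from right to left, it returns to bilinear forms. *)
Lemma dot_mulmx_pair A v w :
  alternating A -> dot v (A *m w) = pair A (wedge v w).
Proof.
move=> [A0 AN]; rewrite /dot /pair.
have -> : \sum_(i < n) v i 0 * (A *m w) i 0 =
  \sum_(i < n) \sum_(j < n | (i < j)%N) v i 0 * A i j * w j 0 +
  \sum_(i < n) \sum_(j < n | (j < i)%N) v i 0 * A i j * w j 0.
  rewrite -big_split; apply: eq_bigr => i _ /=.
  rewrite mxE mulr_sumr.
  under [LHS]eq_bigr => j _ do rewrite mulrA.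
  rewrite (bigID (fun j : 'I_n => (i < j)%N)) /=; congr (_ + _).
  rewrite (bigD1 i) ?ltnn //= A0 mulr0 mul0r add0r.
  by apply: eq_bigl => j; rewrite -leqNgt ltn_neqAle andbC.
(* Exchanging i and j in the lower triangle makes both sums run over i < j. *)
rewrite [X in _ + X](exchange_big_dep xpredT) //= -big_split.
apply: eq_bigr => i _; rewrite -big_split; apply: eq_bigr => j _ /=.
by rewrite wedgeE (AN j i); ring.
Qed.

Lemma dot_wedge a b v w :
  dot v (wedge a b *m w) = dot v a * dot b w - dot v b * dot a w.
Proof.
rewrite !dotE /wedge mulmxBl mulmxBr !mulmxA -!(mulmxA (v^T *m _)).
have mul11 (x y : 'M[T]_1) : (x *m y) 0 0 = x 0 0 * y 0 0.
  by rewrite mxE big_ord1.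
by rewrite mxE [X in _ + X]mxE !mul11.
Qed.

Lemma mxtrace_wedge a b A :
  \tr (wedge a b *m A) = dot b (A *m a) - dot a (A *m b).
Proof.
rewrite /wedge mulmxBl linearB /= -!mulmxA !(mxtrace_mulC _ (_ *m A)) !dotE.
by rewrite !trace_mx11 !mulmxA.
Qed.

Lemma Jmx_wedge i j : Jmx T i j = wedge (delta_mx i 0) (delta_mx j 0).
Proof.
apply/matrixP => p q; rewrite wedgeE !mxE !eqxx !andbT.
by rewrite ![_ == p]eq_sym ![_ == q]eq_sym; ring.
Qed.

(** Entry l of [J_ij u] is entry (i, j) of [wedge e_l u], and the nonlocal
    argument [dot (J_ij u) xi] is entry (i, j) of [wedge xi u]; so entry l of
    the nonlocal part is a pairing, which [dot_mulmx_pair] evaluates. *)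
Lemma Hop_wedge (D : T -> T) (I : {additive T -> T}) u xi :
  Hop D I u xi = map_mx D xi + map_mx I (wedge xi u) *m u.
Proof.
rewrite /Hop; congr (_ + _); apply/matrixP => k z; rewrite (ord1 z) {z}.
have Ju i j l : (Jmx T i j *m u) l 0 = wedge (delta_mx l 0) u i j.
  rewrite Jmx_wedge -dot_delta dot_wedge wedgeE !dot_delta !mxE !eqxx !andbT.
  by rewrite ![l == _]eq_sym; ring.
have dotJ i j : dot (Jmx T i j *m u) xi = wedge xi u i j.
  rewrite Jmx_wedge dotC dot_wedge wedgeE ![dot xi _]dotC !dot_delta.
  by ring.
rewrite -[RHS]dot_delta dot_mulmx_pair; last first.
  exact/alternating_map/alternating_wedge.
rewrite summxE; apply: eq_bigr => i _; rewrite summxE; apply: eq_bigr => j _.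
by rewrite mxE Ju dotJ [in RHS]mxE.
Qed.

End DotWedge.

(** * The derivative of the operator *)

Section Frechet.
Variables (R : realFieldType) (k n : nat) (C : calculus R k).
Implicit Types u P xi : 'cV[C]_n.

(** The product rule in the two places where u occurs: the coefficient of 'X in
    [I (wedge xi (u + 'X P)) (u + 'X P)]. *)
Lemma frechet_Hop u P xi :
  frechet (@Hop n) u P xi =
    map_mx (Dinv C) (wedge xi u) *m P + map_mx (Dinv C) (wedge xi P) *m u.
Proof.
apply/matrixP => i z; rewrite (ord1 z) {z}.
rewrite /frechet mxE horner_coef0 coef_deriv mulr1n.
rewrite (Hop_wedge (map_poly (Dx C)) (map_poly (Dinv C))).
rewrite !mxE coefD coef_map coefC raddf0 add0r coef_sum -big_split.
apply: eq_bigr => j _ /=.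
rewrite ![X in X = _]coefM big_ord_recr big_ord1 /= subnn subn0.
have linE l :
    (map_mx polyC u + 'X *: map_mx polyC P) l 0 = (u l 0)%:P + 'X * (P l 0)%:P.
  by rewrite !mxE.
rewrite ![map_mx (map_poly _) _ _ _]mxE ![map_mx (Dinv C) _ _ _]mxE !coef_map.
rewrite !wedgeE !linE ![map_mx polyC _ _ _]mxE.
rewrite !(coefB, coefD, coefMC, coefCM, coefXM, coefC) /=.
by rewrite !coefX /= !(mul0r, mul1r, addr0, add0r).
Qed.

End Frechet.

(** * Degrees and product rules for vectors and matrices *)

Section Calculus.
Variables (R : realFieldType) (k : nat) (C : calculus R k).
Implicit Types (S : {set 'I_k}) (f g : C).

Lemma deg_opp S f : deg S f -> deg S (- f).
Proof. by move=> df; rewrite -scaleN1r -[_ *: f]addr0; apply/deg_lin/deg0. Qed.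

Lemma deg_add S f g : deg S f -> deg S g -> deg S (f + g).
Proof. by rewrite -[f in f + g]scale1r; apply: deg_lin. Qed.

Lemma deg_sum S (I : Type) (r : seq I) (P : pred I) (F : I -> C) :
  (forall i, P i -> deg S (F i)) -> deg S (\sum_(i <- r | P i) F i).
Proof. by move=> dF; elim/big_ind: _ => //; [apply: deg0 | apply: deg_add]. Qed.

Definition mxdeg S m n (A : 'M[C]_(m, n)) : Prop := forall i j, deg S (A i j).

Lemma mxdeg_vdeg S n (v : 'cV[C]_n) : vdeg S v -> mxdeg S v.
Proof. by move=> dv i j; rewrite (ord1 j). Qed.

Lemma vdeg_add S n (v w : 'cV[C]_n) : vdeg S v -> vdeg S w -> vdeg S (v + w).
Proof. by move=> dv dw i; rewrite mxE; apply: deg_add. Qed.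

Lemma vdeg_Dx S n (v : 'cV[C]_n) : vdeg S v -> vdeg S (map_mx (Dx C) v).
Proof. by move=> dv i; rewrite mxE; apply: deg_Dx. Qed.

Section Products.
Variables S S' : {set 'I_k}.
Hypothesis SS' : [disjoint S & S'].

Lemma mxdeg_mul m n p (A : 'M[C]_(m, n)) (B : 'M[C]_(n, p)) :
  mxdeg S A -> mxdeg S' B -> mxdeg (S :|: S') (A *m B).
Proof. by move=> dA dB i j; rewrite mxE; apply: deg_sum => l _; apply: degM. Qed.

Lemma vdeg_mulmx n (A : 'M[C]_n) (v : 'cV[C]_n) :
  mxdeg S A -> vdeg S' v -> vdeg (S :|: S') (A *m v).
Proof. by move=> dA /mxdeg_vdeg dv i; apply: mxdeg_mul. Qed.

Lemma deg_dot n (v w : 'cV[C]_n) :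
  vdeg S v -> vdeg S' w -> deg (S :|: S') (dot v w).
Proof. by move=> dv dw; apply: deg_sum => i _; apply: degM. Qed.

Lemma deg_pair n (A B : 'M[C]_n) :
  mxdeg S A -> mxdeg S' B -> deg (S :|: S') (pair A B).
Proof. by move=> dA dB; do 2!apply: deg_sum => ? _; apply: degM. Qed.

Lemma deg_trmul n (A B : 'M[C]_n) :
  mxdeg S A -> mxdeg S' B -> deg (S :|: S') (\tr (A *m B)).
Proof. by move=> dA dB; apply: deg_sum => i _; apply: mxdeg_mul. Qed.

Lemma mxdeg_wedge n (v w : 'cV[C]_n) :
  vdeg S v -> vdeg S' w -> mxdeg (S :|: S') (wedge v w).
Proof.
move=> dv dw i j; rewrite wedgeE; apply: deg_add; first exact: degM.
by rewrite mulrC; apply/deg_opp/degM.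
Qed.

End Products.

Lemma Dx_mulmx m n p (A : 'M[C]_(m, n)) (B : 'M[C]_(n, p)) :
  map_mx (Dx C) (A *m B) = map_mx (Dx C) A *m B + A *m map_mx (Dx C) B.
Proof.
apply/matrixP => i j; rewrite !mxE raddf_sum -big_split.
by apply: eq_bigr => l _; rewrite !mxE /= DxM.
Qed.

Lemma Dx_dot n (v w : 'cV[C]_n) :
  Dx C (dot v w) = dot (map_mx (Dx C) v) w + dot v (map_mx (Dx C) w).
Proof.
rewrite raddf_sum -big_split.
by apply: eq_bigr => l _; rewrite !mxE /= DxM.
Qed.

Lemma Dx_pair n (A B : 'M[C]_n) :
  Dx C (pair A B) = pair (map_mx (Dx C) A) B + pair A (map_mx (Dx C) B).
Proof.
rewrite raddf_sum -big_split; apply: eq_bigr => i _ /=.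
rewrite raddf_sum -big_split; apply: eq_bigr => j _ /=.
by rewrite !mxE DxM.
Qed.

Lemma Dx_trmul n (A B : 'M[C]_n) :
  Dx C (\tr (A *m B)) =
    \tr (map_mx (Dx C) A *m B) + \tr (A *m map_mx (Dx C) B).
Proof.
rewrite -linearD /= -Dx_mulmx raddf_sum.
by apply: eq_bigr => i _; rewrite [in RHS]mxE.
Qed.

Section Potential.
Variables (n : nat) (S : {set 'I_k}) (A : 'M[C]_n).
Hypotheses (S0 : S != set0) (ST : S != setT) (dA : mxdeg S A).

Lemma mxdeg_Dinv : mxdeg S (map_mx (Dinv C) A).
Proof. by move=> i j; rewrite mxE; apply: deg_Dinv. Qed.

Lemma DinvK_mx : map_mx (Dx C) (map_mx (Dinv C) A) = A.
Proof. by apply/matrixP => i j; rewrite !mxE; apply: DinvK; last exact: dA. Qed.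

End Potential.

Lemma disjoint_setUl S S' S'' :
  [disjoint S :|: S' & S''] = [disjoint S & S''] && [disjoint S' & S''].
Proof. by rewrite -!setI_eq0 setIUl setU_eq0. Qed.

(** This supplies the properness under which the inverse of D is available: some
    test function is always still missing. *)
Lemma disjoint_neqT S S' : S' != set0 -> [disjoint S & S'] -> S != setT.
Proof.
move=> S'0; apply: contraTneq => ->; rewrite -setI_eq0 setTI; exact: S'0.
Qed.

End Calculus.

(** * Skew-adjointness and the Jacobi identity *)

Section Hamiltonian.
Variables (R : realFieldType) (k n : nat) (C : calculus R k) (u : 'cV[C]_n).
Hypothesis du : vdeg set0 u.
Implicit Types (S : {set 'I_k}) (xi : 'cV[C]_n).

Definition potential xi : 'M[C]_n := map_mx (Dinv C) (wedge xi u).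

Lemma alternating_potential xi : alternating (potential xi).
Proof. exact/alternating_map/alternating_wedge. Qed.

Lemma act_Hop xi : act (@Hop n) u xi = map_mx (Dx C) xi + potential xi *m u.
Proof. exact: Hop_wedge. Qed.

Lemma mxdeg_wedge0 S xi : vdeg S xi -> mxdeg S (wedge xi u).
Proof.
by move=> dxi; rewrite -(setU0 S); apply: mxdeg_wedge; rewrite -?setI_eq0 ?setI0.
Qed.

Lemma mxdeg_potential S xi :
  S != set0 -> S != setT -> vdeg S xi -> mxdeg S (potential xi).
Proof. by move=> S0 ST dxi; apply/mxdeg_Dinv/mxdeg_wedge0. Qed.

Lemma Dx_potential S xi : S != set0 -> S != setT -> vdeg S xi ->
  map_mx (Dx C) (potential xi) = wedge xi u.
Proof. by move=> S0 ST dxi; rewrite (DinvK_mx S0 ST)//; apply: mxdeg_wedge0. Qed.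

Lemma vdeg_act_Hop S xi :
  S != set0 -> S != setT -> vdeg S xi -> vdeg S (act (@Hop n) u xi).
Proof.
move=> S0 ST dxi; rewrite act_Hop; apply: vdeg_add; first exact: vdeg_Dx.
rewrite -(setU0 S); apply: vdeg_mulmx => //; first by rewrite -setI_eq0 setI0.
exact: mxdeg_potential.
Qed.

(** The primitive is [dot xi1 xi2 + pair W1 W2], whose derivative splits into the
    local and the nonlocal parts of the two sides. *)
Lemma Hop_skew_adjoint S1 S2 xi1 xi2 :
  S1 != set0 -> S2 != set0 -> [disjoint S1 & S2] -> S1 :|: S2 = setT ->
  vdeg S1 xi1 -> vdeg S2 xi2 ->
  int_eq (dot xi1 (act (@Hop n) u xi2)) (- dot (act (@Hop n) u xi1) xi2).
Proof.
move=> S10 S20 dis12 U12 d1 d2.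
have S1T := disjoint_neqT S20 dis12.
have S2T : S2 != setT by apply: (disjoint_neqT S10); rewrite disjoint_sym.
exists (dot xi1 xi2 + pair (potential xi1) (potential xi2)).
  rewrite -U12; apply: deg_add; first exact: deg_dot.
  by apply: deg_pair => //; apply: mxdeg_potential.
rewrite linearD /= Dx_dot Dx_pair (Dx_potential S10 S1T d1).
rewrite (Dx_potential S20 S2T d2) opprK !act_Hop.
rewrite [dot (_ + _) xi2]dotC !dotDr !dot_mulmx_pair;
  try exact: alternating_potential.
by rewrite [dot xi2 _]dotC [pair (wedge _ _) _]pairC; ring.
Qed.

(** Closed under rotation, so that the three terms of the Schouten bracket are
    instances of one lemma. *)
Definition tripartition S1 S2 S3 : Prop :=
  [/\ [&& S1 != set0, S2 != set0 & S3 != set0], [disjoint S1 & S2],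
      [disjoint S2 & S3], [disjoint S3 & S1] & S1 :|: S2 :|: S3 = setT].

Lemma tripartition_rot S1 S2 S3 : tripartition S1 S2 S3 -> tripartition S2 S3 S1.
Proof.
case=> /and3P[S10 S20 S30] d12 d23 d31 U.
by split=> //; [rewrite S10 S20 S30 | rewrite -U setUC setUA].
Qed.

Lemma tripartition_proper S1 S2 S3 : tripartition S1 S2 S3 ->
  [/\ S1 != set0, S1 != setT & [disjoint S1 & S2]].
Proof. by case=> /and3P[S10 S20 _] d12 _ _ _; rewrite (disjoint_neqT S20). Qed.

(** Integration by parts removes the only nested D^-1, that of [wedge xi3 P];
    the discarded total derivative is that of its pairing with the potential of
    xi1. *)
Lemma schouten_density_Hop S1 S2 S3 xi1 xi2 xi3 :
  tripartition S1 S2 S3 -> vdeg S1 xi1 -> vdeg S2 xi2 -> vdeg S3 xi3 ->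
  let P := act (@Hop n) u xi2 in
  int_eq (schouten_density (@Hop n) u xi1 xi2 xi3)
    (dot xi1 (potential xi3 *m P) - dot xi3 (potential xi1 *m P)).
Proof.
move=> T123 d1 d2 d3 P.
have [S10 S1T d12] := tripartition_proper T123.
have [S20 S2T d23] := tripartition_proper (tripartition_rot T123).
have [S30 S3T d31] :=
  tripartition_proper (tripartition_rot (tripartition_rot T123)).
have dP : vdeg S2 P by apply: vdeg_act_Hop.
have dis : [disjoint S3 :|: S2 & S1] by rewrite disjoint_setUl d31 disjoint_sym.
have ST : S3 :|: S2 != setT by apply: disjoint_neqT dis.
have S0 : S3 :|: S2 != set0 by rewrite setU_eq0 negb_and S30.
have dA : mxdeg (S3 :|: S2) (wedge xi3 P).
  by apply: mxdeg_wedge => //; rewrite disjoint_sym.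
exists (pair (map_mx (Dinv C) (wedge xi3 P)) (potential xi1)).
  have [_ _ _ _ <-] := T123.
  rewrite -setUA setUC [S2 :|: S3]setUC; apply: deg_pair => //.
    exact: mxdeg_Dinv.
  exact: mxdeg_potential.
rewrite Dx_pair (DinvK_mx S0 ST dA) (Dx_potential S10 S1T d1).
rewrite /schouten_density frechet_Hop dotDr -/(potential xi3).
rewrite [dot xi1 (map_mx _ _ *m u)]dot_mulmx_pair; last first.
  exact/alternating_map/alternating_wedge.
rewrite [dot xi3 _]dot_mulmx_pair; last exact: alternating_potential.
by rewrite [pair (wedge _ _) _]pairC; ring.
Qed.

(** Summed over the cyclic permutations of (v, xa, xb), the last two terms
    cancel: each product [dot xa v * dot u xb] then occurs twice, with opposite
    signs. *)
Lemma Dx_dot_potential v xa xb (W : 'M[C]_n) :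
  map_mx (Dx C) W = wedge v u -> alternating W ->
  Dx C (dot xa (W *m xb)) =
    dot xa (W *m map_mx (Dx C) xb) - dot xb (W *m map_mx (Dx C) xa) +
    (dot xa v * dot u xb - dot xa u * dot v xb).
Proof.
move=> DW sW; rewrite Dx_dot Dx_mulmx DW dotDr dot_wedge.
by rewrite (dot_mulmx_alternating (map_mx _ xa)) //; ring.
Qed.

(** Cyclicity of the trace brings each differentiated factor to the front, where
    its wedge turns the trace into two values of a bilinear form; alternation
    puts u last in both. *)
Lemma Dx_tr_potential v1 v2 v3 (W1 W2 W3 : 'M[C]_n) :
  alternating W1 -> alternating W2 -> alternating W3 ->
  map_mx (Dx C) W1 = wedge v1 u -> map_mx (Dx C) W2 = wedge v2 u ->
  map_mx (Dx C) W3 = wedge v3 u ->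
  Dx C (\tr (W1 *m (W2 *m W3))) =
    (dot v1 (W3 *m (W2 *m u)) - dot v1 (W2 *m (W3 *m u))) +
    (dot v2 (W1 *m (W3 *m u)) - dot v2 (W3 *m (W1 *m u))) +
    (dot v3 (W2 *m (W1 *m u)) - dot v3 (W1 *m (W2 *m u))).
Proof.
move=> sW1 sW2 sW3 DW1 DW2 DW3.
have trW (Wa Wb : 'M[C]_n) v : alternating Wa -> alternating Wb ->
    \tr (wedge v u *m (Wa *m Wb)) =
    dot v (Wb *m (Wa *m u)) - dot v (Wa *m (Wb *m u)).
  move=> sa sb; rewrite mxtrace_wedge -!mulmxA; congr (_ - _).
  by rewrite dot_mulmx_alternating // dotC dot_mulmx_alternating // opprK.
rewrite Dx_trmul Dx_mulmx DW1 DW2 DW3 mulmxDr linearD /= trW //.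
rewrite [\tr (W1 *m (wedge _ _ *m _))]mxtrace_mulC -mulmxA trW //.
rewrite [W1 *m (W2 *m wedge _ _)]mulmxA [\tr (_ *m wedge _ _)]mxtrace_mulC.
by rewrite trW //; ring.
Qed.

(** The primitive combines those of the three integrations by parts with the
    cyclic sum of [dot xi1 (W3 xi2)] and the trace [tr (W1 W2 W3)]. *)
Lemma Hop_jacobi S1 S2 S3 xi1 xi2 xi3 :
  tripartition S1 S2 S3 -> vdeg S1 xi1 -> vdeg S2 xi2 -> vdeg S3 xi3 ->
  int_eq (schouten_density (@Hop n) u xi1 xi2 xi3 +
          schouten_density (@Hop n) u xi2 xi3 xi1 +
          schouten_density (@Hop n) u xi3 xi1 xi2) 0.
Proof.
move=> T123 d1 d2 d3.
have T231 := tripartition_rot T123; have T312 := tripartition_rot T231.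
have [h1 dh1 E1] := schouten_density_Hop T123 d1 d2 d3.
have [h2 dh2 E2] := schouten_density_Hop T231 d2 d3 d1.
have [h3 dh3 E3] := schouten_density_Hop T312 d3 d1 d2.
have [S10 S1T dis12] := tripartition_proper T123.
have [S20 S2T dis23] := tripartition_proper T231.
have [S30 S3T dis31] := tripartition_proper T312.
have dW1 := mxdeg_potential S10 S1T d1.
have dW2 := mxdeg_potential S20 S2T d2.
have dW3 := mxdeg_potential S30 S3T d3.
have DW1 := Dx_potential S10 S1T d1.
have DW2 := Dx_potential S20 S2T d2.
have DW3 := Dx_potential S30 S3T d3.
have sW1 := alternating_potential xi1.
have sW2 := alternating_potential xi2.
have sW3 := alternating_potential xi3.
move: E1 E2 E3; rewrite !act_Hop.
set W1 := potential xi1 in dW1 DW1 sW1 *.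
set W2 := potential xi2 in dW2 DW2 sW2 *.
set W3 := potential xi3 in dW3 DW3 sW3 *.
(* From here on the potentials enter only through D W = wedge xi u and through
   alternation. *)
clearbody W1 W2 W3; move=> E1 E2 E3.
have deg_dotW (Sa Sb Sc : {set 'I_k}) (xa xb : 'cV[C]_n) (W : 'M[C]_n) :
    tripartition Sa Sb Sc -> vdeg Sa xa -> vdeg Sb xb -> mxdeg Sc W ->
    deg setT (dot xa (W *m xb)).
  case=> _ dab dbc dca <- dxa dxb dW.
  rewrite -setUA [Sb :|: _]setUC; apply: deg_dot => //.
    by rewrite disjoint_sym disjoint_setUl dca disjoint_sym.
  by apply: vdeg_mulmx => //; rewrite disjoint_sym.
pose h := dot xi1 (W3 *m xi2) + dot xi2 (W1 *m xi3) + dot xi3 (W2 *m xi1)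
  + \tr (W1 *m (W2 *m W3)).
exists (h1 + h2 + h3 + h).
  apply: deg_add; first by do 2!apply: deg_add => //.
  apply: deg_add; first do 2?apply: deg_add.
  - exact: (deg_dotW S1 S2 S3).
  - exact: (deg_dotW S2 S3 S1).
  - exact: (deg_dotW S3 S1 S2).
  have [_ _ _ _ <-] := T123; rewrite -setUA.
  apply: deg_trmul => //; last exact: mxdeg_mul.
  by rewrite disjoint_sym disjoint_setUl dis31 disjoint_sym dis12.
rewrite subr0 !linearD /= -E1 -E2 -E3.
rewrite (Dx_dot_potential _ _ DW3) // (Dx_dot_potential _ _ DW1) //.
rewrite (Dx_dot_potential _ _ DW2) // (Dx_tr_potential sW1 sW2 sW3 DW1 DW2 DW3).
rewrite !mulmxDr !dotDr (dotC u xi1) (dotC u xi2) (dotC u xi3).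
rewrite (dotC xi2 xi1) (dotC xi3 xi2) (dotC xi1 xi3).
(* What is left is an identity between polynomials in these scalars. *)
do 3![move: (schouten_density _ _ _ _ _) => ?].
do ![move: (dot _ _) => ?].
by ring.
Qed.

End Hamiltonian.

Lemma tripartition3 : tripartition [set 0 : 'I_3] [set 1] [set 2%:R].
Proof.
split; rewrite ?disjoints1 ?inE //.
  by rewrite -!card_gt0 !cards1.
by apply/setP => -[[|[|[|]]]] //= i; rewrite !inE.
Qed.

Theorem proposition2 (R : realFieldType) (n : nat) : cosymplectic R (@Hop n).
Proof.
split=> [C u xi1 xi2 du | C u xi1 xi2 xi3 du].
  apply: Hop_skew_adjoint; rewrite -?card_gt0 ?cards1 ?disjoints1 ?inE //.
  by apply/setP => -[[|[|]]] //= i; rewrite !inE.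
exact: Hop_jacobi tripartition3.
Qed.
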